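(* Let $n\geq 10$ with $n\equiv 2\pmod 4$ and $r=4$. Let $V=\{v_1,\dots,v_n\}$ and consider the labelled path graph with edges: $\{v_1,v_2\}$ with the two labels $0$ and $2$; $\{v_2,v_3\}$ with label $1$; $\{v_3,v_4\}$ with label $0$; $\{v_4,v_5\}$ with label $1$; and for $5\leq s\leq n-1$, $\{v_s,v_{s+1}\}$ with label $2$ if $s$ is odd and label $3$ if $s$ is even. Then $G\cong A_n$ and $(G,(\rho_0,\rho_1,\rho_2,\rho_3))$ is a string C-group of rank 4 with Schläfli type $\{5,6,n-4\}$.
   Context: A string group generated by involutions (sggi) of rank $r$ is a pair $(G,(\rho_0,\dots,\rho_{r-1}))$ where $\rho_0,\dots,\rho_{r-1}$ are involutions generating the group $G$ such that $(\rho_i\rho_j)^2=1$ whenever $|i-j|\geq 2$. It is a string C-group if in addition it satisfies the intersection property: for all $J,K\subseteq\{0,\dots,r-1\}$, $\langle \rho_j : j\in J\rangle\cap\langle\rho_k : k\in K\rangle=\langle \rho_j : j\in J\cap K\rangle$. The Schläfli type is $\{p_1,\dots,p_{r-1}\}$ where $p_i$ is the order of $\rho_{i-1}\rho_i$. Labelled-graph convention: the vertex set $V$ is finite, and each edge $\{a,b\}$ ($a\neq b$) carries one or more labels from $\{0,\dots,r-1\}$, the edges carrying any given label being pairwise disjoint; $\rho_k$ denotes the permutation of $V$ equal to the product of the transpositions $(a\,b)$ over all edges $\{a,b\}$ carrying label $k$, and $G=\langle\rho_0,\dots,\rho_{r-1}\rangle\leq \mathrm{Sym}(V)$. *)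

(* Defs.v *)
From HB Require Import structures.
From mathcomp Require Import all_boot all_fingroup all_solvable.
Set Implicit Arguments. Unset Strict Implicit. Unset Printing Implicit Defensive.
Import GroupScope.

(* A labelled graph on vertex set 'I_n is given by a list of edges;
   each edge is (a, b, labels): endpoints a, b (as naturals < n) and the
   list of labels it carries.  rho_k is the product of the transpositions
   (a b) over all edges carrying label k (these edges are pairwise disjoint,
   so the order of the product is irrelevant). *)
Definition edge := (nat * nat * seq nat)%type.

Definition lg_rho (n : nat) (E : seq edge) (k : nat) : {perm 'I_n.+1} :=
  \prod_(e <- E | k \in e.2) tperm (inord e.1.1) (inord e.1.2).

Definition sggi (gT : finGroupType) (G : {set gT}) (r : nat) (rho : nat -> gT) : Prop :=
  [/\ forall i, i < r -> #[rho i] = 2,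
      G = <<[set rho (val i) | i : 'I_r]>> &
      forall i j, i < r -> j < r -> i.+1 < j -> (rho i * rho j) ^+ 2 = 1].

Definition intersection_property (gT : finGroupType) (r : nat) (rho : nat -> gT) : Prop :=
  forall J K : {set 'I_r},
    <<[set rho (val j) | j in J]>> :&: <<[set rho (val k) | k in K]>>
    = <<[set rho (val j) | j in J :&: K]>>.

Definition string_C_group (gT : finGroupType) (G : {set gT}) (r : nat) (rho : nat -> gT) : Prop :=
  sggi G r rho /\ intersection_property r rho.

Definition schlafli_type (gT : finGroupType) (r : nat) (rho : nat -> gT) (p : seq nat) : Prop :=
  size p = r.-1 /\ forall i, i.+1 < r -> #[rho i * rho i.+1] = nth 0 p i.

(* The labelled path graph of Theorem 4.2, on vertices v_1..v_n encoded as
   0..n-1 (v_s is s-1). *)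
Definition path_edges (n : nat) : seq edge :=
  ([:: (0, 1, [:: 0; 2]); (1, 2, [:: 1]); (2, 3, [:: 0]); (3, 4, [:: 1])] ++
  [seq (s.-1, s, [:: if odd s then 2 else 3]) | s <- iota 5 (n - 5)])%N.

(* Main.v *)
Require Import Defs.
From mathcomp Require Import all_boot all_fingroup all_solvable.
From mathcomp Require Import zify.
Import GroupScope.

(** Vertices are numbered from 0. Write [hat i] for the parabolic subgroup generated by the rho_j with
    [j != i]. The intersection property amounts to: an element lying in [hat i] for every [i] outside
    [p] lies in the parabolic subgroup of [p]. Pairwise intersections of the [hat i] settle this:
    [hat 0], [hat 2] and [hat 3] preserve the first 3, 5 and 6 vertices; [hat 1] and [hat 2] are the
    direct products <rho_0> x <rho_2, rho_3> and <rho_0, rho_1> x <rho_3>; and [hat 3] is A_5 x C_2 of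
    order 120, where A_5 acts on the first six vertices as PSL(2, 5) and C_2 is generated by
    (6 7)(8 9)... on the others, so that questions about it are settled by enumeration, uniformly in
    the number of vertices.

    The group A_5 inside [hat 3] contains (0 1)(4 5); multiplied by its conjugate (0 1)(4 6) under
    rho_3 it gives a 3-cycle. Starting from {4, 5, 6}, the set S of vertices such that all even
    permutations of S belong to the group grows by one vertex at a time, by conjugating 3-cycles by
    the generators. *)

(** * The generators as permutations of the vertices *)

Definition pathcond (m k i : nat) : bool :=
  match k with
  | 0 => i < 4
  | 1 => 0 < i < 5
  | 2 => (i < 2) || (3 < i)
  | _ => 4 < i < m
  end.

(** Each edge labelled [k] joins some [i] to [i.+1] with [i + k] even, so the parity of [i + k]
    tells which neighbour a moved vertex goes to; [pathcond] is the support. The last vertex is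
    [m]. *)
Definition pathfun (m k i : nat) : nat :=
  (if pathcond m k i then if odd (i + k) then i.-1 else i.+1 else i)%N.

Lemma val_tperm_inord m (a b : nat) (i : 'I_m.+1) : a <= m -> b <= m ->
  tperm (inord a) (inord b) i =
  (if i == a :> nat then b else if i == b :> nat then a else i) :> nat.
Proof.
move=> am bm; have [ai|ai] := eqVneq (nat_of_ord i) a.
  have -> : i = inord a by apply/val_inj; rewrite /= inordK.
  by rewrite tpermL /= !inordK.
have [bi|bi] := eqVneq (nat_of_ord i) b.
  have -> : i = inord b by apply/val_inj; rewrite /= inordK.
  by rewrite tpermR /= !inordK.
by rewrite tpermD // -val_eqE /= inordK // eq_sym.
Qed.

(** The first [p] edges of the alternating tail that starts at vertex 4. A free [p] permits
    induction by appending one edge at the end. *)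
Definition tail_edges p : seq edge :=
  [seq (s.-1, s, [:: if odd s then 2 else 3]) | s <- iota 5 p]%N.

Lemma lg_rho_tailS m p k : lg_rho m (tail_edges p.+1) k =
  lg_rho m (tail_edges p) k *
  (if k == (if odd p then 3 else 2) then tperm (inord (p + 4)) (inord (p + 5)) else 1).
Proof.
rewrite /lg_rho /tail_edges -[p.+1]addn1 iotaD map_cat big_cat; congr (_ * _).
rewrite big_cons big_nil /= inE /= mulg1 ![(_ + p)%N]addnC.
by rewrite addn0; case: (odd p).
Qed.

(** The bounds say that the edge at [i] lies in the part built so far, whose last vertex is [p + 4];
    an end whose edge is still missing is fixed. *)
Lemma val_lg_rho_tail m p k (i : 'I_m.+1) : (p + 4 <= m)%N -> 1 < k < 4 ->
  lg_rho m (tail_edges p) k i =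
  (let j := if odd (i + k) then i.-1 else i.+1 in
   if [&& k.+1 < i, i <= p + 4 & j <= p + 4] then j else i)%N :> nat.
Proof.
move=> + k4; elim: p => [|p IHp] hp /=.
  rewrite /lg_rho big_nil perm1; case: ifP => //; case: ifP; lia.
rewrite lg_rho_tailS permM; set t := lg_rho _ _ _ i in IHp *.
have {}IHp := IHp (ltac:(lia)); case: (k =P _) => [kE|kN].
  rewrite val_tperm_inord; [rewrite IHp /= {t IHp}|lia|lia].
  by do ?case: ifP => //=; move: kE; case: ifP; lia.
rewrite perm1 IHp /= {t IHp}.
by do ?case: ifP => //=; move: kN; case: ifP; lia.
Qed.

Lemma path_edgesE m : path_edges m.+1 =
  [:: (0, 1, [:: 0; 2]); (1, 2, [:: 1]); (2, 3, [:: 0]); (3, 4, [:: 1])]%N ++ tail_edges (m - 4).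
Proof. by rewrite /path_edges subSS. Qed.

Lemma lg_rho_tail0 m p k : k < 2 -> lg_rho m (tail_edges p) k = 1.
Proof.
move=> k2; elim: p => [|p IHp]; first by rewrite /lg_rho big_nil.
rewrite lg_rho_tailS IHp; case: (k =P _) => [kE|_]; last exact: mulg1.
by rewrite kE in k2; case: (odd p) k2.
Qed.

Lemma lg_rho_path m k : lg_rho m (path_edges m.+1) k =
  lg_rho m [:: (0, 1, [:: 0; 2]); (1, 2, [:: 1]); (2, 3, [:: 0]); (3, 4, [:: 1])]%N k *
  lg_rho m (tail_edges (m - 4)) k.
Proof. by rewrite path_edgesE /lg_rho big_cat. Qed.

Lemma val_rho m k (i : 'I_m.+1) : 9 <= m -> m %% 4 = 1%N -> k < 4 ->
  lg_rho m (path_edges m.+1) k i = pathfun m k i :> nat.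
Proof.
move=> m9 m41; have im := ltn_ord i.
rewrite lg_rho_path permM.
case: k => [|[|k]] k4; last rewrite val_lg_rho_tail; try lia.
- rewrite lg_rho_tail0 // perm1 /lg_rho !big_cons big_nil /= mulg1 permM !val_tperm_inord; try lia.
  rewrite /pathfun /=; do ?case: ifP => //=; lia.
- rewrite lg_rho_tail0 // perm1 /lg_rho !big_cons big_nil /= mulg1 permM !val_tperm_inord; try lia.
  rewrite /pathfun /=; do ?case: ifP => //=; lia.
case: k k4 => [|[|//]] _; rewrite /lg_rho !big_cons big_nil /= ?mulg1.
  rewrite val_tperm_inord; try lia.
  rewrite /pathfun /=; do ?case: ifP => //=; lia.
rewrite perm1 /pathfun /=; do ?case: ifP => //=; lia.
Qed.

Lemma odd_lg_rho_tail m p k : (p + 4 <= m)%N -> 1 < k < 4 ->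
  odd_perm (lg_rho m (tail_edges p) k) = odd (if k == 2 then uphalf p else p./2)%N.
Proof.
move=> + k4; elim: p => [|p IHp] hp /=.
  by rewrite /lg_rho big_nil odd_perm1; case: ifP.
rewrite lg_rho_tailS odd_permM IHp; last lia.
have -> : odd_perm (if k == (if odd p then 3 else 2) then
  tperm (inord (p + 4)) (inord (p + 5)) else 1 : {perm 'I_m.+1}) = (k == (if odd p then 3 else 2))%N.
  case: (k =P _) => _; last exact: odd_perm1.
  by rewrite odd_tperm -val_eqE /= !inordK; lia.
have [-> | ->] : k = 2 \/ k = 3 by lia.
  by case: ifP => /=; lia.
by case: ifP => /=; lia.
Qed.

(** The tail has [m - 4] edges, congruent to 1 modulo 4: an odd number carry label 2, to which (0 1)
    is added, and an even number carry label 3. *)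
Lemma even_rho m k : 9 <= m -> m %% 4 = 1%N -> k < 4 ->
  odd_perm (lg_rho m (path_edges m.+1) k) = false.
Proof.
move=> m9 m41 k4; rewrite lg_rho_path odd_permM.
case: k k4 => [|[|k]] k4; last rewrite odd_lg_rho_tail; try lia.
- by rewrite lg_rho_tail0 // /lg_rho !big_cons big_nil /= mulg1 odd_permM odd_perm1
    !odd_tperm -!val_eqE /= !inordK; lia.
- by rewrite lg_rho_tail0 // /lg_rho !big_cons big_nil /= mulg1 odd_permM odd_perm1
    !odd_tperm -!val_eqE /= !inordK; lia.
case: k k4 => [|[|//]] _; rewrite /lg_rho !big_cons big_nil /= ?mulg1.
  by rewrite odd_tperm -val_eqE /= !inordK; lia.
by rewrite odd_perm1; lia.
Qed.

(** * Even permutations supported on a set *)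

Lemma perm_on_setU1 (T : finType) (S : {set T}) y (g : {perm T}) :
  perm_on (y |: S) g -> g y = y -> perm_on S g.
Proof.
move=> /subsetP gS gy; apply/subsetP=> x gx; have := gS x gx.
by case/setU1P=> // xy; move: gx; rewrite inE xy gy eqxx.
Qed.

(** Coset argument: if [g] moves [y], some [c] in [G] brings [g y] back to [y], so [g * c] fixes [y]
    and is an even permutation of [S]. *)
Lemma even_perm_on_setU1 (T : finType) (G : {group {perm T}}) (S : {set T}) y :
  (forall g, perm_on S g -> ~~ odd_perm g -> g \in G) ->
  {in S, forall x, exists c, [/\ c \in G, perm_on (y |: S) c, ~~ odd_perm c & c x = y]} ->
  forall g, perm_on (y |: S) g -> ~~ odd_perm g -> g \in G.
Proof.
move=> SG yc g gS even_g; have : g y \in y |: S by rewrite (perm_closed y gS) setU11.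
case/setU1P=> [gy|/yc[c [cG cS even_c cgy]]].
  by apply: SG => //; apply: perm_on_setU1 gS gy.
rewrite -[g](mulgK c) groupM ?groupV //; apply: SG.
  by apply: (perm_on_setU1 _ _ y); [exact: perm_onM | rewrite permM].
by rewrite odd_permM (negbTE even_g) (negbTE even_c).
Qed.

(** Conjugating a 3-cycle on [x, u, v] by [r] gives a 3-cycle on [r x, r u, r v] that sends [r v], a
    point of [S], to the new point [r x]. Any other point of [S] is first sent to [r v] inside
    [S]. *)
Lemma even_perm_on_adjoin (T : finType) (G : {group {perm T}}) (S : {set T}) (r : {perm T}) x u v :
  uniq [:: x; u; v] -> x \in S -> u \in S -> v \in S ->
  r \in G -> r u \in S -> r v \in S ->
  (forall g, perm_on S g -> ~~ odd_perm g -> g \in G) ->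
  forall g, perm_on (r x |: S) g -> ~~ odd_perm g -> g \in G.
Proof.
rewrite /= !inE negb_or !andbT -andbA => /and3P[xu xv uv] xS uS vS rG ruS rvS SG.
have tpermS a b : a \in S -> b \in S -> perm_on S (tperm a b).
  move=> aS bS; apply/subsetP=> z; rewrite inE.
  by case: tpermP => [->|->|] //; rewrite eqxx.
have even_on a b c : a \in S -> b \in S -> c \in S -> a != b -> a != c ->
    perm_on S (tperm a b * tperm a c) /\ ~~ odd_perm (tperm a b * tperm a c).
  move=> aS bS cS ab ac; split; first by rewrite perm_onM ?tpermS.
  by rewrite odd_permM !odd_tperm ab ac.
apply: even_perm_on_setU1 => // z zS.
pose c := (tperm x u * tperm x v) ^ r.
have [on0 even0] := even_on x u v xS uS vS xu xv.
have cG : c \in G by rewrite groupJ // SG.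
have cS : perm_on (r x |: S) c.
  apply/subsetP=> a; rewrite inE -[a](permKV r) /c permJ (inj_eq perm_inj) permM.
  have [->|bx] := eqVneq (r^-1 a) x; first by rewrite setU11.
  have [->|bu] := eqVneq (r^-1 a) u; first by rewrite setU1r.
  have [->|bv] := eqVneq (r^-1 a) v; first by rewrite setU1r.
  by rewrite !tpermD ?eqxx // eq_sym.
have crv : c (r v) = r x by rewrite /c permJ permM (tpermD xv uv) tpermR.
have even_c : ~~ odd_perm c by rewrite /c odd_permJ.
have [->|zrv] := eqVneq z (r v); first by exists c.
(* A third point of [S] allows a 3-cycle, hence an even permutation, to take [z] to [r v]. *)
have [t /and3P[tS zt trv]] : exists t, [&& t \in S, z != t & t != r v].
  have [xz|xz] := eqVneq z x; have [xr|xr] := eqVneq x (r v).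
  - by rewrite xz xr eqxx in zrv.
  - have [ur|ur] := eqVneq u (r v); last by exists u; rewrite uS ur xz xu.
    by exists v; rewrite vS xz xv -ur eq_sym uv.
  - have [zu|zu] := eqVneq z u; first by exists v; rewrite vS zu uv -xr eq_sym xv.
    by exists u; rewrite uS zu -xr eq_sym xu.
  by exists x; rewrite xS xz xr.
have [on1 even1] := even_on z (r v) t zS rvS tS zrv zt.
exists (tperm z (r v) * tperm z t * c); split.
- by rewrite groupM // SG.
- apply: perm_onM => //; apply/subsetP=> a /(subsetP on1); apply: setU1r.
- by rewrite odd_permM (negbTE even1) (negbTE even_c).
by rewrite 2!permM tpermL (tpermD zrv) ?crv //.
Qed.

(** * Parabolic subgroups *)

Definition parabolic {gT : finGroupType} (r : nat) (rho : nat -> gT) (p : pred nat) : {group gT} :=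
  <<[set rho (val i) | i : 'I_r & p (val i)]>>%G.

Lemma mem_parabolic {gT : finGroupType} {r} {rho : nat -> gT} {p : pred nat} k :
  k < r -> p k -> rho k \in parabolic r rho p.
Proof.
by move=> kr pk; apply/mem_gen/imsetP; exists (Ordinal kr); rewrite ?inE.
Qed.

Lemma parabolicP {gT : finGroupType} {r} {rho : nat -> gT} {p : pred nat} g :
  reflect (exists2 w : seq nat, all (fun k => (k < r) && p k) w & g = \prod_(k <- w) rho k)
    (g \in parabolic r rho p).
Proof.
apply: (iffP idP) => [/gen_prodgP[l [c cA ->]]|[w + ->]].
  elim: l c cA => [|l IHl] c cA; first by exists [::]; rewrite ?big_nil ?big_ord0.
  have [|w wp wE] := IHl (fun i => c (lift ord0 i)); first by move=> i; apply: cA.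
  have /imsetP[k + ck] := cA ord0; rewrite inE => pk.
  by exists (val k :: w); rewrite /= ?ltn_ord ?pk // big_cons big_ord_recl ck wE.
elim: w => [|k w IHw] /=; first by rewrite big_nil group1.
by case/andP=> /andP[kr pk] /IHw; rewrite big_cons; apply/groupM/mem_parabolic.
Qed.

Lemma parabolicS {gT : finGroupType} {r} {rho : nat -> gT} {p q : pred nat} :
  (forall k, k < r -> p k -> q k) -> parabolic r rho p \subset parabolic r rho q.
Proof.
move=> pq; rewrite gen_subG; apply/subsetP => _ /imsetP[i + ->]; rewrite inE => pi.
by apply: mem_parabolic; [exact: ltn_ord | exact: (pq _ (ltn_ord i))].
Qed.

Lemma parabolic_ind [gT : finGroupType] [r] [rho : nat -> gT] [p : pred nat] (P : gT -> Prop) :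
  P 1 -> (forall k g, k < r -> p k -> P g -> P (rho k * g)) ->
  forall g, g \in parabolic r rho p -> P g.
Proof.
move=> P1 PM _ /parabolicP[w + ->].
elim: w => [|k w IHw] /=; first by rewrite big_nil.
by case/andP=> /andP[kr pk] /IHw; rewrite big_cons; apply: PM.
Qed.

(** An index outside the intersection of [J] and [K] is missing from one of them, so an element of
    both subgroups lies in the corresponding maximal parabolic. *)
Lemma intersection_property_maximal {gT : finGroupType} r (rho : nat -> gT) :
  (forall (p : pred nat) g, g \in parabolic r rho predT ->
     (forall i, i < r -> ~~ p i -> g \in parabolic r rho (predC1 i)) -> g \in parabolic r rho p) ->
  intersection_property r rho.
Proof.
pose pd (J : {set 'I_r}) : pred nat := fun k => [exists i : 'I_r, (i \in J) && (val i == k)].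
have pdE J (i : 'I_r) : pd J i = (i \in J).
  apply/existsP/idP => [[j /andP[jJ /eqP/val_inj <-]] //|iJ].
  by exists i; rewrite iJ eqxx.
have genE (J : {set 'I_r}) : <<[set rho (val j) | j in J]>> = parabolic r rho (pd J).
  by congr (generated _); apply/setP=> x; apply/imsetP/imsetP=> -[i];
    rewrite ?inE ?pdE => iJ ->; exists i; rewrite ?inE ?pdE.
move=> cap J K; rewrite !genE; apply/eqP; rewrite eqEsubset; apply/andP; split.
  apply/subsetP => g /setIP[gJ gK]; apply: cap => [|i ir].
    by apply: (subsetP (parabolicS _)) gJ.
  rewrite (pdE _ (Ordinal ir)) inE negb_and => /orP[] iN.
    apply: (subsetP (parabolicS _)) gJ => k kr; rewrite (pdE _ (Ordinal kr)) /=.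
    by apply: contraTneq => ki; rewrite (_ : Ordinal kr = Ordinal ir) //; apply: val_inj.
  apply: (subsetP (parabolicS _)) gK => k kr; rewrite (pdE _ (Ordinal kr)) /=.
  by apply: contraTneq => ki; rewrite (_ : Ordinal kr = Ordinal ir) //; apply: val_inj.
by rewrite subsetI !parabolicS // => k kr; rewrite !(pdE _ (Ordinal kr)) => /setIP[].
Qed.

(** * Enumeration of <rho_0, rho_1, rho_2> *)

Definition mate i := (if odd i then i.-1 else i.+1)%N.

(* A pair (s, b) encodes the permutation acting as s on the first six vertices and, when b holds, as
   (6 7)(8 9)... on the others. *)
Definition code := (seq nat * bool)%type.

Definition code_fun (c : code) i :=
  (if i < 6 then nth 0 c.1 i else if c.2 then mate i else i)%N.

(** Left multiplication by [rho k], for [k < 3]. These generators agree on the first six vertices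
    for all [m], so [pathfun 9] represents them; beyond, only [rho 2] acts, as [mate], and toggles
    the bit. *)
Definition code_step k (c : code) : code :=
  ([seq nth 0 c.1 (pathfun 9 k i) | i <- iota 0 6], c.2 (+) (k == 2))%N.

Definition word_code (w : seq nat) : code := foldr code_step (iota 0 6, false) w.

(* 15 is the diameter of the Cayley graph of the Coxeter group H_3 of order 120. *)
Definition codes : seq code :=
  iter 15 (fun l => undup (l ++ [seq code_step k c | k <- iota 0 3, c <- l])) [:: (iota 0 6, false)].

Lemma codes_closed : all (fun c => all (fun k => code_step k c \in codes) (iota 0 3)) codes.
Proof. by vm_compute. Qed.

(** Words for the twelve elements of the dihedral group <rho_1, rho_2>. *)
Definition dihedral_words : seq (seq nat) :=
  [seq nseq e 1 ++ flatten (nseq k [:: 1; 2]) | e <- iota 0 2, k <- iota 0 6]%N.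

Lemma codes_stab012 : all (fun c : code => all (fun i => nth 0 c.1 i < 3) (iota 0 3) ==>
  (c \in [seq word_code w | w <- dihedral_words])) codes.
Proof. by vm_compute. Qed.

(** The list is a Klein four-group: 1, [rho 2], the tail involution (6 7)(8 9)... and its product
    with [rho 2]. The last two will be shown to lie outside <rho_2, rho_3>. *)
Lemma codes_stab01_2_3 : all (fun c : code =>
  [&& nth 0 c.1 0 < 2, nth 0 c.1 1 < 2, nth 0 c.1 2 == 2 & nth 0 c.1 3 == 3] ==>
  (c \in [:: word_code [::]; word_code [:: 2];
     (iota 0 6, true); ([:: 1; 0; 2; 3; 5; 4], false)]))%N codes.
Proof. by vm_compute. Qed.

Lemma codes_stab012_5 : all (fun c : code =>
  [&& nth 0 c.1 5 == 5, ~~ c.2 & all (fun i => nth 0 c.1 i < 3) (iota 0 3)] ==>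
  (c \in [:: word_code [::]; word_code [:: 1]]))%N codes.
Proof. by vm_compute. Qed.

Lemma word_codes w : all (gtn 3) w -> word_code w \in codes.
Proof.
elim: w => [|k w IHw] /=; first by vm_compute.
case/andP=> k3 /IHw /(allP codes_closed) /allP; apply.
by rewrite mem_iota.
Qed.


(** * The path graph *)

Section PathGraph.

Variables (m : nat) (m9 : 9 <= m) (m41 : m %% 4 = 1%N).

Let rho := lg_rho m (path_edges m.+1).
Let P (s : seq nat) := parabolic 4 rho (mem s).

Let rhoE k (i : 'I_m.+1) : k < 4 -> rho k i = pathfun m k i :> nat.
Proof. exact: val_rho. Qed.

Let pt_inj (g h : {perm 'I_m.+1}) : (forall i, g i = h i :> nat) -> g = h.
Proof. by move=> gh; apply/permP=> i; apply/val_inj/gh. Qed.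

Lemma rhoK k : k < 4 -> rho k * rho k = 1.
Proof.
move=> k4; apply: pt_inj => i; rewrite permM !rhoE // perm1 /pathfun; have := ltn_ord i.
case: k k4 => [|[|[|[|//]]]] _ /=; do ?case: ifP => //=; lia.
Qed.

Lemma rho_comm j k : j.+1 < k < 4 -> rho j * rho k = rho k * rho j.
Proof.
move=> jk; apply: pt_inj => i; rewrite !permM !rhoE /pathfun; try lia.
have := ltn_ord i.
case: k jk => [|[|[|[|k]]]] jk /=; case: j jk => [|[|[|j]]] jk /=; do ?case: ifP => //=; lia.
Qed.

(** The bridge from enumeration to the group: vertices below 6 and vertices from 6 on are never
    mixed by the first three generators. *)
Lemma word_codeE (w : seq nat) (i : 'I_m.+1) : all (gtn 3) w ->
  (\prod_(k <- w) rho k) i = code_fun (word_code w) i :> nat.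
Proof.
elim: w i => [|k w IHw] i /=.
  by rewrite big_nil perm1 /code_fun /=; case: ifP => // i6; rewrite (nth_iota 0 0 i6).
case/andP=> k3 /IHw {}IHw; rewrite big_cons permM IHw rhoE ?(leq_trans k3) //.
rewrite /code_fun; have [i6|i6] := ltnP i 6.
  rewrite (nth_map 0) ?size_iota // nth_iota // add0n.
  have -> : pathfun m k i = pathfun 9 k i by case: k k3 => [|[|[|//]]] _.
  suff -> : pathfun 9 k i < 6 by [].
  by move: (nat_of_ord i) i6 k k3 => [|[|[|[|[|[|//]]]]]] _ [|[|[|]]].
have [->|/negbTE k2] := eqVneq k 2.
  rewrite /= addbT /pathfun /mate /= orbC (ltn_trans _ i6) //= !addnS addn0 /= negbK.
  have -> : ((if odd i then i.-1 else i.+1) < 6 = false)%N by case: ifP; lia.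
  by case: (word_code w).2 => //=; do ?case: ifP => //; lia.
have -> : pathfun m k i = i.
  by case: k k3 k2 => [|[|[|//]]] _ //= _; rewrite /pathfun /=; case: ifP => //; lia.
by rewrite /= k2 addbF ltnNge i6.
Qed.

Lemma word_code_inj (w1 w2 : seq nat) : all (gtn 3) w1 -> all (gtn 3) w2 ->
  word_code w1 = word_code w2 -> \prod_(k <- w1) rho k = \prod_(k <- w2) rho k.
Proof. by move=> w13 w23 w12; apply: pt_inj => i; rewrite !word_codeE // w12. Qed.

Lemma parabolic_hat3P g : g \in parabolic 4 rho (predC1 3) ->
  exists2 w : seq nat, all (gtn 3) w & g = \prod_(k <- w) rho k.
Proof.
case/parabolicP=> w wp ->; exists w => //; apply: sub_all wp => k /=; lia.
Qed.

Let mem_rho (s : seq nat) k : k < 4 -> k \in s -> rho k \in P s.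
Proof. by move=> k4 ks; apply: mem_parabolic. Qed.

(** * Invariant vertex sets and direct-product splittings of the maximal parabolics *)

Lemma parabolic_stable (p : pred nat) b :
  (forall k i, k < 4 -> p k -> i <= m -> (pathfun m k i < b) = (i < b)) ->
  forall g, g \in parabolic 4 rho p -> forall i, (g i < b) = (i < b).
Proof.
move=> pb g gP; elim/parabolic_ind: g / gP => [i|k g k4 pk IHg i]; first by rewrite perm1.
by rewrite permM IHg rhoE // pb // -ltnS.
Qed.

Lemma parabolic_fix (p : pred nat) a :
  (forall k, k < 4 -> p k -> pathfun m k a = a) ->
  forall g, g \in parabolic 4 rho p -> forall i : 'I_m.+1, i = a :> nat -> g i = i.
Proof.
move=> pa g gP; elim/parabolic_ind: g / gP => [i|k g k4 pk IHg i ia]; first by rewrite perm1.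
have rki : rho k i = i by apply/val_inj; rewrite /= rhoE // ia pa.
by rewrite permM rki IHg.
Qed.

Lemma hat0_stable g i : g \in parabolic 4 rho (predC1 0) -> (g i < 3) = (i < 3).
Proof.
move=> gP; apply: parabolic_stable gP i => -[|[|[|[|//]]]] //= i _ _ im;
  rewrite /pathfun /=; do ?case: ifP => //=; lia.
Qed.

Lemma hat2_stable g i : g \in parabolic 4 rho (predC1 2) -> (g i < 5) = (i < 5).
Proof.
move=> gP; apply: parabolic_stable gP i => -[|[|[|[|//]]]] //= i _ _ im;
  rewrite /pathfun /=; do ?case: ifP => //=; lia.
Qed.

Lemma hat3_stable g i : g \in parabolic 4 rho (predC1 3) -> (g i < 6) = (i < 6).
Proof.
move=> gP; apply: parabolic_stable gP i => -[|[|[|[|//]]]] //= i _ _ im;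
  rewrite /pathfun /=; do ?case: ifP => //=; lia.
Qed.

Lemma parabolic_nil g : g \in P [::] -> g = 1.
Proof. by move=> gP; elim/parabolic_ind: g / gP. Qed.

(** Since [rho j] commutes with the other generators, its occurrences gather in front and cancel in
    pairs. *)
Lemma parabolic_split j s g : j < 4 ->
  {in s, forall k, k < 4 -> rho j * rho k = rho k * rho j} ->
  g \in P (j :: s) -> g \in P s \/ rho j * g \in P s.
Proof.
move=> j4 cj gP; elim/parabolic_ind: g / gP => [|k g k4]; first by left; apply: group1.
rewrite /= inE => /predU1P[->|ks] [gP|gP]; [right|left|left|right] => //.
- by rewrite mulgA rhoK // mul1g.
- by rewrite groupM // mem_rho.
by rewrite mulgA cj // -mulgA groupM // mem_rho.
Qed.

Let hatS (i : nat) (s : seq nat) : all (fun k => (k == i) || (k \in s)) (iota 0 4) ->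
  parabolic 4 rho (predC1 i) \subset P s.
Proof.
move=> /allP is_; apply: parabolicS => k k4 /= ki.
by have := is_ k; rewrite mem_iota k4 (negbTE ki); apply.
Qed.

Let PS s p : all p s -> P s \subset parabolic 4 rho p.
Proof. by move=> /allP sp; apply: parabolicS => k _; apply: sp. Qed.

Lemma hat1_split g : g \in parabolic 4 rho (predC1 1%N) ->
  g \in P [:: 2; 3] \/ rho 0 * g \in P [:: 2; 3].
Proof.
move=> gP; apply: parabolic_split => //; last exact: (subsetP (hatS 1%N [:: 0; 2; 3] _)) gP.
by move=> k; rewrite !inE => /orP[]/eqP-> _; apply: rho_comm.
Qed.

Lemma hat2_split g : g \in parabolic 4 rho (predC1 2) ->
  g \in P [:: 0; 1]%N \/ rho 3 * g \in P [:: 0; 1]%N.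
Proof.
move=> gP; apply: parabolic_split => //; last exact: (subsetP (hatS 2 [:: 3; 0; 1]%N _)) gP.
by move=> k; rewrite !inE => /orP[]/eqP-> _; apply/esym/rho_comm.
Qed.

Let mulKrho k g : k < 4 -> rho k * (rho k * g) = g.
Proof. by move=> k4; rewrite mulgA rhoK // mul1g. Qed.

(** * The dihedral subgroup <rho_2, rho_3> *)

Definition path_cycle := rho 2 * rho 3.

(** The orbit of 4 climbs through the even vertices 4, 6, ..., m - 1, turns at the end of the path
    and returns through the odd vertices m, ..., 7, 5: a cycle of length [m - 3]. *)
Lemma path_cycle_iter k (i : 'I_m.+1) : i = 4 :> nat -> k < m - 3 ->
  (path_cycle ^+ k) i = (if k.*2 < m - 3 then 4 + k.*2 else 2 * m - 3 - k.*2)%N :> nat.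
Proof.
move=> i4; elim: k => [|k IHk] km; first by rewrite perm1 i4 /=; case: ifP; lia.
rewrite expgSr !permM !rhoE // IHk /pathfun /=; last lia.
by do ?case: ifP => //=; lia.
Qed.

Lemma path_cycle_expn : path_cycle ^+ (m - 3) = 1.
Proof.
have cE4 (i : 'I_m.+1) : i = 4 :> nat -> (path_cycle ^+ (m - 3)) i = i.
  move=> i4; apply/val_inj; have -> : (m - 3 = (m - 4).+1)%N by lia.
  rewrite expgSr !permM /= !rhoE // path_cycle_iter //; last lia.
  by rewrite /pathfun /=; do ?case: ifP => //=; lia.
have four_lt : 4 < m.+1 by lia.
pose x4 := Ordinal four_lt.
apply/permP=> i; rewrite perm1; have im := ltn_ord i.
have [i4|i4] := ltnP i 4; last first.
  have [k km <-] : exists2 k, k < m - 3 & (path_cycle ^+ k) x4 = i.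
    (* Inverse of the formula in [path_cycle_iter]: even vertices on the way up, odd ones on the way
       back. *)
    exists (if odd i then (2 * m - 3 - i)./2 else (i - 4)./2); first by case: ifP; lia.
    by apply/val_inj; rewrite /= path_cycle_iter //; do ?case: ifP => //; lia.
  by rewrite -!permM -expgD addnC expgD permM cE4.
(* Below 4 the product acts as (0 1), and [m - 3] is even. *)
have c2 : (path_cycle ^+ 2) i = i.
  apply/val_inj; rewrite /= expgS expg1 !permM !rhoE // /pathfun /=.
  by do ?case: ifP => //=; lia.
have -> : (m - 3 = 2 * (m - 3)./2)%N by lia.
rewrite expgM; elim: _./2 => [|e IHe]; first by rewrite perm1.
by rewrite expgS permM c2.
Qed.

Lemma path_cycle_fix k (i : 'I_m.+1) : i = 4 :> nat -> (path_cycle ^+ k) i = i -> m - 3 %| k.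
Proof.
move=> i4; have -> : path_cycle ^+ k = path_cycle ^+ (k %% (m - 3)).
  by rewrite {1}(divn_eq k (m - 3)) expgD mulnC expgM path_cycle_expn expg1n mul1g.
have kl : k %% (m - 3) < m - 3 by rewrite ltn_mod; lia.
move/(congr1 val); rewrite /= path_cycle_iter // i4 /dvdn.
by case: ifP; lia.
Qed.

Lemma order_path_cycle : #[path_cycle] = (m - 3)%N.
Proof.
have four_lt : 4 < m.+1 by lia.
apply/eqP; rewrite eqn_dvd order_dvdn path_cycle_expn eqxx /=.
by apply: (path_cycle_fix _ (Ordinal four_lt)) => //; rewrite expg_order perm1.
Qed.

Lemma parabolic23_dihedral g : g \in P [:: 2; 3] ->
  g \in <[path_cycle]> \/ rho 3 * g \in <[path_cycle]>.
Proof.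
move=> gP; elim/parabolic_ind: g / gP => [|k g k4]; first by left; apply: group1.
rewrite /= !inE => /orP[]/eqP-> [gC|gC].
- right; rewrite mulgA (_ : rho 3 * rho 2 = path_cycle^-1).
    by rewrite groupM // groupV cycle_id.
  by apply/esym/mulg1_eq; rewrite -mulgA mulKrho // rhoK.
- left; rewrite -[g](mulKrho 3) // mulgA; apply: groupM => //; exact: cycle_id.
- by right; rewrite mulKrho.
by left.
Qed.

(** Elements of <rho_2, rho_3> preserve {0, 1} and fix 2 and 3, so enumeration leaves four
    candidates; the two besides 1 and [rho 2] are not in the dihedral group. *)
Lemma parabolic23_hat3 g : g \in P [:: 2; 3] -> g \in parabolic 4 rho (predC1 3) ->
  g \in P [:: 2].
Proof.
move=> g23 g3; have [w w3 gw] := parabolic_hat3P _ g3.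
have v_lt k : k < 10 -> k < m.+1 by lia.
pose v k (k10 : k < 10) : 'I_m.+1 := Ordinal (v_lt k k10).
have gE i : g i = code_fun (word_code w) i :> nat by rewrite gw word_codeE.
have two_stable : (forall i, (g i < 2) = (i < 2)).
  apply: parabolic_stable g23 => k i _; rewrite /= !inE => /orP[]/eqP-> im;
    rewrite /pathfun /=; do ?case: ifP => //=; lia.
have g_2 : g (v 2 isT) = v 2 isT.
  by apply: parabolic_fix g23 _ _ => // k _; rewrite /= !inE => /orP[]/eqP->.
have g_3 : g (v 3 isT) = v 3 isT.
  by apply: parabolic_fix g23 _ _ => // k _; rewrite /= !inE => /orP[]/eqP->.
(* The permutation (6 7)(8 9)... fixes the adjacent vertices 4 and 5 of the polygon on which
   <rho 2, rho 3> acts dihedrally. *)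
have not_tail h : h \in P [:: 2; 3] -> h (v 4 isT) = v 4 isT -> h (v 5 isT) = v 5 isT ->
    h (v 6 isT) = v 7 isT -> False.
  case/parabolic23_dihedral=> /cycleP[k hk] h4 h5 h6.
    have /dvdnP[q kq] : m - 3 %| k by apply: path_cycle_fix (v 4 isT) _ _; rewrite // -hk.
    by move: h6; rewrite hk kq mulnC expgM path_cycle_expn expg1n perm1 => /(congr1 val).
  (* A reflection fixing 4 must be [rho 3], which moves 5. *)
  have r34 : rho 3 (v 4 isT) = v 4 isT by apply/val_inj; rewrite /= rhoE.
  have /dvdnP[q kq] : m - 3 %| k.
    by apply: path_cycle_fix (v 4 isT) _ _; rewrite // -hk permM r34.
  have : rho 3 * h = 1 by rewrite hk kq mulnC expgM path_cycle_expn expg1n.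
  move/(congr1 (fun x => rho 3 * x)); rewrite mulKrho // mulg1 => h3.
  move/(congr1 val): h5; rewrite /= h3 rhoE // /pathfun /=; case: ifP; lia.
suff [->|->] : g = 1 \/ g = rho 2; [exact: group1 | exact: mem_rho |].
have := allP codes_stab01_2_3 _ (word_codes _ w3).
have codeE k (k10 : k < 10) : k < 6 -> nth 0 (word_code w).1 k = g (v k k10).
  by move=> k6; rewrite gE /code_fun /= k6.
rewrite (codeE 0 isT) // (codeE 1%N isT) // (codeE 2 isT) // (codeE 3 isT) // !two_stable g_2 g_3.
rewrite !inE /=; case/or4P=> /eqP wE.
- by left; rewrite gw (word_code_inj w [::]) // big_nil.
- by right; rewrite gw (word_code_inj w [:: 2]) // big_seq1.
- exfalso; apply: (not_tail g) => //; apply/val_inj; rewrite /= gE wE //.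
(* Multiplying by [rho 2] turns the fourth candidate into the tail involution. *)
exfalso; apply: (not_tail (rho 2 * g)); first by rewrite groupM // mem_rho.
- by apply/val_inj; rewrite /= permM gE rhoE // wE.
- by apply/val_inj; rewrite /= permM gE rhoE // wE.
by apply/val_inj; rewrite /= permM gE rhoE // wE.
Qed.


(** * Intersections of parabolic subgroups *)

(** The generators [rho 0], [rho 2], [rho 3] move the vertices 2, 5, 6 across the boundary of the
    initial segment that the matching parabolic preserves. *)
Lemma rho_notin_hat k : k < 4 -> k != 1%N -> rho k \notin parabolic 4 rho (predC1 k).
Proof.
move=> k4 k1; apply/negP => rk.
have [l2 l5 l6] : [/\ 2 < m.+1, 5 < m.+1 & 6 < m.+1] by split; lia.
case: k k4 k1 rk => [|[|[|[|//]]]] //= _ _ rk.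
- by have := hat0_stable _ (Ordinal l2) rk; rewrite rhoE.
- by have := hat2_stable _ (Ordinal l5) rk; rewrite rhoE.
by have := hat3_stable _ (Ordinal l6) rk; rewrite rhoE // /pathfun /=; case: ifP; lia.
Qed.

(** Otherwise [rho k] itself would lie in [hat k]. This discards the second alternative of
    [parabolic_split]. *)
Lemma rho_coset_hat k s g : k < 4 -> k != 1%N -> k \notin s ->
  g \in parabolic 4 rho (predC1 k) -> rho k * g \notin P s.
Proof.
move=> k4 k1 ks gk; apply: contra (rho_notin_hat k k4 k1) => rg.
rewrite -(groupMr _ gk); apply: subsetP rg; apply: PS; apply/allP => i si /=.
by apply: contraNneq ks => <-.
Qed.

Lemma hat0_hat3 g : g \in parabolic 4 rho (predC1 0) -> g \in parabolic 4 rho (predC1 3) ->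
  g \in P [:: 1; 2]%N.
Proof.
move=> g0 /parabolic_hat3P[w w3 gw].
have /implyP/(_ _)/mapP[|w' w'D ww'] := allP codes_stab012 _ (word_codes _ w3).
  apply/allP=> i; rewrite mem_iota /= => i3; have im : i < m.+1 by lia.
  have := hat0_stable g (Ordinal im) g0; rewrite gw word_codeE // /code_fun /= i3.
  by have -> : i < 6 by lia.
have [w'12 w'3] : all [in [:: 1; 2]%N] w' /\ all (gtn 3) w'.
  by split; apply: allP w'D; vm_compute.
rewrite gw (word_code_inj _ _ w3 w'3 ww'); apply/parabolicP; exists w' => //.
by apply: sub_all w'12 => k /=; rewrite !inE => /orP[]/eqP->.
Qed.

Lemma hat1_hat3 g : g \in parabolic 4 rho (predC1 1%N) -> g \in parabolic 4 rho (predC1 3) ->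
  g \in P [:: 0; 2].
Proof.
move=> /hat1_split g1 g3; have sub : P [:: 2] \subset P [:: 0; 2] by apply: PS.
case: g1 => g23; first by rewrite (subsetP sub) // parabolic23_hat3.
rewrite -(mulKrho 0 g) // groupM ?mem_rho //; apply: (subsetP sub).
by rewrite parabolic23_hat3 // groupM // mem_parabolic.
Qed.

Lemma parabolic01_fix g (i : 'I_m.+1) : g \in P [:: 0; 1]%N -> 4 < i -> g i = i.
Proof.
move=> gP i4; apply: parabolic_fix gP _ (erefl _) => k _.
by rewrite /= !inE => /orP[]/eqP->; rewrite /pathfun /=; case: ifP => //; lia.
Qed.

Lemma hat2_hat3 g : g \in parabolic 4 rho (predC1 2) -> g \in parabolic 4 rho (predC1 3) ->
  g \in P [:: 0; 1]%N.
Proof.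
by move=> /hat2_split[//|g01] /(rho_coset_hat 3 [:: 0; 1]%N)/negP[].
Qed.

Lemma parabolic01_hat0 g : g \in P [:: 0; 1]%N -> g \in parabolic 4 rho (predC1 0) ->
  g \in P [:: 1]%N.
Proof.
move=> g01 g0.
have /parabolic_hat3P[w w3 gw] : g \in parabolic 4 rho (predC1 3) by apply: subsetP g01; apply: PS.
suff [->|->] : g = 1 \/ g = rho 1; [exact: group1 | exact: mem_rho |].
have := allP codes_stab012_5 _ (word_codes _ w3).
have -> : all (fun i => nth 0 (word_code w).1 i < 3) (iota 0 3).
  apply/allP=> i; rewrite mem_iota /= => i3; have im : i < m.+1 by lia.
  have := hat0_stable g (Ordinal im) g0; rewrite gw word_codeE // /code_fun /= i3.
  by have -> : i < 6 by lia.
(* Vertex 6 reads off the tail bit of the code; vertex 5 is the last entry of its list. *)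
have lt6 : 6 < m.+1 by lia.
have lt5 : 5 < m.+1 by lia.
have /(congr1 val) := parabolic01_fix g (Ordinal lt5) g01 isT.
have /(congr1 val) := parabolic01_fix g (Ordinal lt6) g01 isT.
rewrite /= gw !word_codeE // /code_fun /=; case: ((word_code w).2) => //= _ ->.
rewrite eqxx !inE /= => /orP[]/eqP wE; [left | right].
  by rewrite (word_code_inj w [::]) // big_nil.
by rewrite (word_code_inj w [:: 1%N]) // big_seq1.
Qed.

Lemma hat0_hat2 g : g \in parabolic 4 rho (predC1 0) -> g \in parabolic 4 rho (predC1 2) ->
  g \in P [:: 1; 3]%N.
Proof.
move=> g0 /hat2_split g2; have sub : P [:: 1]%N \subset P [:: 1; 3]%N by apply: PS.
case: g2 => g01; first by rewrite (subsetP sub) // parabolic01_hat0.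
rewrite -(mulKrho 3 g) // groupM ?mem_rho //; apply: (subsetP sub).
by rewrite parabolic01_hat0 // groupM // mem_parabolic.
Qed.

Lemma hat0_hat1 g : g \in parabolic 4 rho (predC1 0) -> g \in parabolic 4 rho (predC1 1%N) ->
  g \in P [:: 2; 3].
Proof.
by move=> /(rho_coset_hat 0 [:: 2; 3])/negP g0 /hat1_split[//|/g0]; case.
Qed.

(** Splitting off [rho 0] and then [rho 3] leaves an element of both <rho_2, rho_3> and <rho_0,
    rho_1>, which is trivial. *)
Lemma hat1_hat2 g : g \in parabolic 4 rho (predC1 1%N) -> g \in parabolic 4 rho (predC1 2) ->
  g \in P [:: 0; 3].
Proof.
suff key h : h \in P [:: 2; 3] -> h \in parabolic 4 rho (predC1 2) -> h \in P [:: 0; 3].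
  move=> /hat1_split[g23|g23] g2; first exact: key.
  by rewrite -(mulKrho 0 g) // groupM ?mem_rho // key // groupM // mem_parabolic.
suff key0 x : x \in P [:: 2; 3] -> x \in P [:: 0; 1]%N -> x = 1.
  move=> h23 /hat2_split[h01|h01]; first by rewrite (key0 h) ?group1.
  rewrite -(mulKrho 3 h) // (key0 (rho 3 * h)) ?mulg1 ?mem_rho //.
  by rewrite groupM // mem_rho.
move=> x23 x01.
have x3 : x \in parabolic 4 rho (predC1 3) by apply: subsetP x01; apply: PS.
have [] := parabolic_split 2 [::] x isT _ (parabolic23_hat3 _ x23 x3).
- by [].
- exact: parabolic_nil.
have x2 : x \in parabolic 4 rho (predC1 2) by apply: subsetP x01; apply: PS.
by move=> x2'; have := rho_coset_hat 2 [::] x isT isT isT x2; rewrite x2'.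
Qed.

Lemma parabolic_cap (p : pred nat) g : g \in parabolic 4 rho predT ->
  (forall i, i < 4 -> ~~ p i -> g \in parabolic 4 rho (predC1 i)) -> g \in parabolic 4 rho p.
Proof.
move=> gT hat.
have split j k : j.+1 < k < 4 -> g \in P [:: j; k] ->
    (g \in P [:: k] \/ rho j * g \in P [:: k]) /\ (g \in P [:: j] \/ rho k * g \in P [:: j]).
  move=> jk gjk; split; apply: parabolic_split => //; try lia.
  - by move=> i; rewrite inE => /eqP-> _; apply: rho_comm.
  - by move=> i; rewrite inE => /eqP-> _; apply/esym/rho_comm.
  by apply: subsetP gjk; apply: PS; rewrite /= !inE !eqxx !orbT.
have sub s : g \in P s -> all p s -> g \in parabolic 4 rho p.
  by move=> gs ps; apply: subsetP gs; apply: PS.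
(* Sixteen subsets: with two indices missing a pairwise intersection applies; with more missing, the
   result is split further and the wrong coset discarded. *)
have [p0|/(hat 0 isT) g0] := boolP (p 0); have [p1|/(hat 1%N isT) g1] := boolP (p 1%N);
  have [p2|/(hat 2 isT) g2] := boolP (p 2); have [p3|/(hat 3 isT) g3] := boolP (p 3).
- by apply: subsetP gT; apply: parabolicS => -[|[|[|[|]]]].
- by apply: subsetP g3; apply: parabolicS => -[|[|[|[|]]]].
- by apply: subsetP g2; apply: parabolicS => -[|[|[|[|]]]].
- by apply: sub (hat2_hat3 _ g2 g3) _; rewrite /= p0 p1.
- by apply: subsetP g1; apply: parabolicS => -[|[|[|[|]]]].
- by apply: sub (hat1_hat3 _ g1 g3) _; rewrite /= p0 p2.
- by apply: sub (hat1_hat2 _ g1 g2) _; rewrite /= p0 p3.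
- have [_ [g02|gN]] := split 0 2 isT (hat1_hat3 _ g1 g3);
    last by case/negP: (rho_coset_hat 2 [:: 0] g isT isT isT g2).
  by apply: sub g02 _; rewrite /= p0.
- by apply: subsetP g0; apply: parabolicS => -[|[|[|[|]]]].
- by apply: sub (hat0_hat3 _ g0 g3) _; rewrite /= p1 p2.
- by apply: sub (hat0_hat2 _ g0 g2) _; rewrite /= p1 p3.
- have [_ [g13|gN]] := split 1%N 3 isT (hat0_hat2 _ g0 g2);
    last by case/negP: (rho_coset_hat 3 [:: 1%N] g isT isT isT g3).
  by apply: sub g13 _; rewrite /= p1.
- by apply: sub (hat0_hat1 _ g0 g1) _; rewrite /= p2 p3.
- have [[g02|gN] _] := split 0 2 isT (hat1_hat3 _ g1 g3);
    last by case/negP: (rho_coset_hat 0 [:: 2] g isT isT isT g0).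
  by apply: sub g02 _; rewrite /= p2.
- have [[g03|gN] _] := split 0 3 isT (hat1_hat2 _ g1 g2);
    last by case/negP: (rho_coset_hat 0 [:: 3] g isT isT isT g0).
  by apply: sub g03 _; rewrite /= p3.
have [[g03|gN] _] := split 0 3 isT (hat1_hat2 _ g1 g2);
    last by case/negP: (rho_coset_hat 0 [:: 3] g isT isT isT g0).
have [] := parabolic_split 3 [::] g isT _ g03; first by [].
  by move=> g_; apply: sub g_ _.
by move=> gN; case/negP: (rho_coset_hat 3 [::] g isT isT isT g3).
Qed.

(** * The generated group *)

Lemma even_parabolic p g : g \in parabolic 4 rho p -> odd_perm g = false.
Proof.
move=> gP; elim/parabolic_ind: g / gP => [|k g k4 _]; first exact: odd_perm1.
by rewrite odd_permM even_rho.
Qed.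

Let interval a b := [set i : 'I_m.+1 | a <= i < b].
Let alt_in a b := forall g : {perm 'I_m.+1},
  perm_on (interval a b) g -> ~~ odd_perm g -> g \in parabolic 4 rho predT.

Lemma alt_in_adjoin a b k (x u v : nat) : k < 4 -> uniq [:: x; u; v] ->
  all (fun i => (a <= i < b) && (i <= m)) [:: x; u; v] ->
  pathfun m k u = u -> pathfun m k v = v ->
  alt_in a b -> forall g, perm_on [set i : 'I_m.+1 | (i == pathfun m k x :> nat) || (a <= i < b)] g ->
    ~~ odd_perm g -> g \in parabolic 4 rho predT.
Proof.
move=> k4 xuv /and4P[/andP[abx xm] /andP[abu um] /andP[abv vm] _] ru rv ab g gS even_g.
pose w i := inord i : 'I_m.+1.
have [wx wu wv] : [/\ w x = x :> nat, w u = u :> nat & w v = v :> nat] by rewrite !inordK.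
apply: (@even_perm_on_adjoin _ _ (interval a b) (rho k) (w x) (w u) (w v)) => //.
- by move: xuv; rewrite /= !inE -!val_eqE /= wx wu wv.
- by rewrite inE wx.
- by rewrite inE wu.
- by rewrite inE wv.
- exact: mem_parabolic.
- by rewrite inE rhoE // wu ru.
- by rewrite inE rhoE // wv rv.
apply: subset_trans gS _; apply/subsetP => i; rewrite !inE => /orP[/eqP ix|->]; last by rewrite orbT.
by rewrite -val_eqE /= rhoE // wx ix eqxx.
Qed.

Lemma alt_in_down a : 0 < a < 5 -> alt_in a 7 -> alt_in a.-1 7.
Proof.
move=> a5 alt_a g gS; pose k := if odd a then 0 else 1%N.
(* [rho k] pulls in the vertex below [a] and fixes 5 and 6. *)
have kE : pathfun m k a = a.-1 by rewrite /k; move: a a5 {alt_a gS k} => [|[|[|[|[|]]]]].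
apply: (@alt_in_adjoin a 7 k a 5 6 _ _ _ _ _ alt_a).
- by rewrite /k; case: odd.
- by rewrite /= !inE; lia.
- by rewrite /=; lia.
- by rewrite /k; case: odd.
- by rewrite /k; case: odd.
by apply: subset_trans gS _; apply/subsetP => i; rewrite !inE kE; lia.
Qed.

Lemma alt_in_up b : 7 <= b <= m -> alt_in 0 b -> alt_in 0 b.+1.
Proof.
move=> b7 alt_b g gS; pose k := if odd b then 2 else 3.
(* [rho k] carries the last vertex [b.-1] to [b] and fixes 2 and 3. *)
have kE : pathfun m k b.-1 = b.
  by rewrite /k; case: ifP => bo; rewrite /pathfun /=; do ?case: ifP => //; lia.
apply: (@alt_in_adjoin 0 b k b.-1 2 3 _ _ _ _ _ alt_b).
- by rewrite /k; case: odd.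
- by rewrite /= !inE; lia.
- by rewrite /=; lia.
- by rewrite /k; case: odd.
- by rewrite /k; case: odd.
by apply: subset_trans gS _; apply/subsetP => i; rewrite !inE kE; lia.
Qed.

(* The word [w] below acts as (0 1)(4 5), being rho 2 times the central element
   (rho 0 rho 1 rho 2)^5 = (6 7)(8 9)... of <rho 0, rho 1, rho 2>. *)
Lemma three_cycle : exists2 c, c \in parabolic 4 rho predT &
  forall i, c i = (if i == 4 :> nat then 5 else if i == 5 :> nat then 6
                   else if i == 6 :> nat then 4 else i) :> nat.
Proof.
pose w := (2 :: flatten (nseq 5 [:: 0; 1%N; 2]))%N; pose x := \prod_(k <- w) rho k.
have xE (i : 'I_m.+1) : x i = (if i == 0 :> nat then 1 else if i == 1%N :> nat then 0 else
    if i == 4 :> nat then 5 else if i == 5 :> nat then 4 else i)%N :> nat.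
  rewrite /x word_codeE // (_ : word_code w = ([:: 1%N; 0; 2; 3; 5; 4], false)) //.
  by rewrite /code_fun /=; move: (nat_of_ord i) => [|[|[|[|[|[|]]]]]].
have xT : x \in parabolic 4 rho predT by apply/parabolicP; exists w.
exists (x * (rho 3 * x * rho 3)); first by rewrite !groupM // mem_parabolic.
move=> i; rewrite !permM rhoE // xE rhoE // xE /pathfun /=; have := ltn_ord i.
by do ?case: ifP => //=; lia.
Qed.

(** Only the identity is an even permutation of {4, 5}; vertex 6 is adjoined because [c] sends 5 to
    6 and [c * c] sends 4 to 6. *)
Lemma alt_in_4_7 : alt_in 4 7.
Proof.
have [c cT cE] := three_cycle.
have [l4 l5 l6] : [/\ 4 < m.+1, 5 < m.+1 & 6 < m.+1] by split; lia.
pose v4 := Ordinal l4; pose v5 := Ordinal l5; pose v6 := Ordinal l6.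
rewrite /alt_in (_ : interval 4 7 = v6 |: [set v4; v5]); last first.
  by apply/setP => i; rewrite !inE -!val_eqE /=; lia.
have cS : perm_on (v6 |: [set v4; v5]) c.
  apply/subsetP => i; rewrite !inE -!val_eqE /= cE.
  by do ?case: ifP => //=; lia.
have [c4 c5] : c v4 = v5 /\ c v5 = v6 by split; apply/val_inj; rewrite /= cE.
have even_c := even_parabolic _ _ cT.
apply: even_perm_on_setU1 => [g gS even_g|i].
  have : g v4 \in [set v4; v5] by rewrite (perm_closed _ gS) set21.
  rewrite !inE => /orP[]/eqP g4.
    suff -> : g = 1 by rewrite group1.
    apply/permP=> i; rewrite perm1.
    have [/set2P[->//|->]|/(out_perm gS)//] := boolP (i \in [set v4; v5]).
    have : g v5 \in [set v4; v5] by rewrite (perm_closed _ gS) set22.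
    by rewrite !inE -[X in g _ == X]g4 (inj_eq perm_inj) -val_eqE /= => /eqP.
  suff gt : g = tperm v4 v5 by move: even_g; rewrite gt odd_tperm.
  apply/permP=> i; case: tpermP => [->|->|/eqP i4 /eqP i5] //; last first.
    by apply: (out_perm gS); rewrite !inE negb_or i4.
  have : g v5 \in [set v4; v5] by rewrite (perm_closed _ gS) set22.
  by rewrite !inE orbC -[X in g _ == X]g4 (inj_eq perm_inj) -val_eqE /= => /eqP.
case/set2P=> ->; last by exists c; rewrite even_c.
exists (c * c); split; [exact: groupM | exact: perm_onM | by rewrite odd_permM even_c |].
by rewrite permM c4.
Qed.

Lemma generated_Alt : parabolic 4 rho predT = 'Alt_('I_m.+1) :> {set _}.
Proof.
have alt b : 7 <= b <= m.+1 -> alt_in 0 b.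
  (* At 7, four downward steps lead from {4, 5, 6} to {0, ..., 6}; from there the set grows
     upwards. *)
  elim: b => // b IHb b7; have [b6|b6] := eqVneq b 6.
    by rewrite b6; do 4!apply: (alt_in_down _.+1) => //; exact: alt_in_4_7.
  by apply: alt_in_up; [lia | apply: IHb; lia].
apply/setP => g; apply/idP/idP => [/even_parabolic geven|]; rewrite Alt_even.
  by rewrite /= geven.
move=> even_g; apply: (alt m.+1) => //; first lia.
by apply/subsetP => i _; rewrite inE /=.
Qed.

(** * Orders *)

Lemma order_rho k : k < 4 -> #[rho k] = 2.
Proof.
move=> k4; apply: nt_prime_order => //; first by rewrite expgS expg1 rhoK.
pose v := if k == 3 then 5 else if k == 1%N then 1%N else 0.
have vm : v < m.+1 by rewrite /v; do ?case: ifP; lia.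
apply/eqP => /permP/(_ (Ordinal vm))/(congr1 val); rewrite /= perm1 rhoE //= /v /pathfun.
by case: k k4 {v vm} => [|[|[|[|]]]] //= _; case: ifP => //; lia.
Qed.

Lemma expg_rhoM i j e : (rho i * rho j) ^+ e = \prod_(k <- flatten (nseq e [:: i; j])) rho k.
Proof.
elim: e => [|e IHe]; first by rewrite big_nil.
by rewrite expgS IHe /= !big_cons mulgA.
Qed.

Lemma order_rho01 : #[rho 0 * rho 1] = 5.
Proof.
have x5 : (rho 0 * rho 1) ^+ 5 = 1.
  by rewrite expg_rhoM (word_code_inj _ [::]) ?big_nil.
apply: nt_prime_order => //; apply/eqP => /permP/(_ ord0)/(congr1 val).
by rewrite /= perm1 permM !rhoE.
Qed.

(** The order divides 6. The square moves vertex 0, and the cube moves vertex 6, where only [rho 2]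
    acts. *)
Lemma order_rho12 : #[rho 1 * rho 2] = 6.
Proof.
have l6 : 6 < m.+1 by lia.
have : #[rho 1 * rho 2] %| 6 by rewrite order_dvdn expg_rhoM (word_code_inj _ [::]) ?big_nil.
have : ~~ (#[rho 1 * rho 2] %| 2).
  rewrite order_dvdn expg_rhoM; apply/eqP => /permP/(_ ord0)/(congr1 val).
  by rewrite /= perm1 word_codeE.
have : ~~ (#[rho 1 * rho 2] %| 3).
  rewrite order_dvdn expg_rhoM; apply/eqP => /permP/(_ (Ordinal l6))/(congr1 val).
  by rewrite /= perm1 word_codeE.
move: #[_] => [|[|[|[|[|[|[|o]]]]]]] // _ _ /dvdn_leq; lia.
Qed.

End PathGraph.

Theorem theorem4p2 (n : nat) (hn : 10 <= n) (hmod : n %% 4 = 2) :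
  let rho := lg_rho n.-1 (path_edges n) in
  let G := <<[set rho (val i) | i : 'I_4]>> in
  G \isog ('Alt_('I_n.-1.+1)) /\
  string_C_group G 4 rho /\ schlafli_type 4 rho [:: 5; 6; n - 4].
Proof.
case: n hn hmod => // m m9 m42 rho G; have m41 : m %% 4 = 1%N by lia.
have GE : G = parabolic 4 rho predT.
  by congr (generated _); apply/setP=> x; apply/imsetP/imsetP=> -[i _ ->]; exists i.
split; first by rewrite GE (generated_Alt m m9 m41) isog_refl.
split; last first.
  split=> // -[|[|[|//]]] _ /=.
  - exact: order_rho01.
  - exact: order_rho12.
  by rewrite (order_path_cycle m m9 m41); lia.
split; last by apply: intersection_property_maximal; exact: parabolic_cap.
split=> // [i i4|i j i4 j4 ij]; first exact: order_rho.
rewrite expgS expg1 mulgA -(mulgA (rho i)) -(rho_comm m m9 m41) ?ij //.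
by rewrite !mulgA rhoK // mul1g rhoK.
Qed.
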